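(* For every $n\in\mathbb{N}$, the partial order $\leq$ on $B_n$ is the natural partial order on the set $S(n)$ of subobjects of $n$ in the triangular category $B$ of bipartite graphs. That is, viewing each element of $B_n$ with basis $\{1,\ldots,k\}$ as a morphism $k\to n$ of $B$, the set $B_n$ is the set $S(n)$ of monomorphisms of $B$ into $n$, and for all $U=(X_1,X_2,E(U))$ and $V=(Y_1,Y_2,E(V))$ in $B_n$, $$|X_1|\leq |Y_1| \ \text{ and } \ \{(i,j)\in E(U) \mid j>|Y_1|\}=\{(i,j)\in E(V)\mid i\leq |X_1|\}$$ if and only if there exists a morphism $W\in\mathrm{Hom}_B(|X_1|,|Y_1|)$ with $V\bullet W=U$.
   Context: Here $\mathbb{N}$ is the set of nonnegative integers. An element of $B_n$ ($n\in\mathbb{N}$) is a bipartite graph $U=(X_1,X_2,E(U))$ with vertex set $\{1,\ldots,n\}$, where $X_1=\{1,2,\ldots,k\}$ for some $0\leq k\leq n$ (called the basis of $U$; it is empty if $k=0$), $X_2=\{k+1,\ldots,n\}$, and the edge set $E(U)$ is an arbitrary subset of $X_1\times X_2$; an edge joining $i\in X_1$ and $j\in X_2$ is written $(i,j)$, so $(i,j)\in E(U)$ implies $i<j$. The basis is part of the data: two elements of $B_n$ with the same edge set but different bases are distinct. The partial order on $B_n$ is defined, for $U=(X_1,X_2,E(U))$ and $V=(Y_1,Y_2,E(V))$, by $$U\leq V \iff |X_1|\leq |Y_1| \ \text{ and } \ \{(i,j)\in E(U) \mid j>|Y_1|\}=\{(i,j)\in E(V)\mid i\leq |X_1|\}.$$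 The category $B$ of bipartite graphs has object set $\mathbb{N}$; for $k\leq n$, $\mathrm{Hom}_B(k,n)$ is the set of all $U\in B_n$ with basis $\{1,\ldots,k\}$, and $\mathrm{Hom}_B(k,n)=\emptyset$ if $k>n$. For $U\in\mathrm{Hom}_B(m,k)$ and $V\in\mathrm{Hom}_B(k,n)$, the composition $V\bullet U\in\mathrm{Hom}_B(m,n)$ is the bipartite graph on $\{1,\ldots,n\}$ with basis $\{1,\ldots,m\}$ and edge set $E(V\bullet U)=E(U)\cup\{(i,j)\in E(V)\mid i\leq m\}$. The identity morphism of $n$ is the graph on $\{1,\ldots,n\}$ with basis $\{1,\ldots,n\}$ and no edges. A triangular category is a category $C$ whose set of objects is $\mathbb{N}$, whose Hom-sets are finite, and such that $|\mathrm{Hom}_C(n,n)|=1$ for all $n\in\mathbb{N}$ and $|\mathrm{Hom}_C(m,n)|=0$ whenever $m>n$. In a triangular category, $S(n)$ denotes the set of all monomorphisms with codomain $n$ (the ''subobjects'' of $n$), and the natural partial order on $S(n)$ is given by $\alpha\leq\beta\iff$ there exists a morphism $\gamma$ with $\beta\gamma=\alpha$ (first $\gamma$, then $\beta$). *)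

(* Defs.v *)
(* MathComp, with finite sets over a choiceType from finmap. *)
From HB Require Import structures.
From mathcomp Require Import all_boot all_order finmap.
From mathcomp Require Import zify.

Set Implicit Arguments.
Unset Strict Implicit.
Unset Printing Implicit Defensive.

Local Open Scope fset_scope.

(** * Triangular categories *)

(* The set of objects is [nat]; finiteness of the Hom-sets is carried by
   [finType].  [tcomp b a] is "first [a], then [b]". *)
Record triangularCategory := TriangularCategory {
  Hom : nat -> nat -> finType;
  tid : forall n, Hom n n;
  tcomp : forall m k n, Hom k n -> Hom m k -> Hom m n;
  tcomp1f : forall m n (f : Hom m n), tcomp (tid n) f = f;
  tcompf1 : forall m n (f : Hom m n), tcomp f (tid m) = f;
  tcompA : forall l m k n (h : Hom k n) (g : Hom m k) (f : Hom l m),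
    tcomp h (tcomp g f) = tcomp (tcomp h g) f;
  card_Hom_diag : forall n, #|Hom n n| = 1;
  card_Hom_gt : forall m n, n < m -> #|Hom m n| = 0
}.
Arguments tid {_} n.
Arguments tcomp {_ m k n}.

Definition monic (C : triangularCategory) (k n : nat) (f : Hom C k n) : Prop :=
  forall m (g h : Hom C m k), tcomp f g = tcomp f h -> g = h.

(* Morphisms with codomain [n] and arbitrary domain. *)
Definition homTo (C : triangularCategory) (n : nat) := {k : nat & Hom C k n}.

(* The set S(n), as a predicate on [homTo C n]. *)
Definition subobject (C : triangularCategory) (n : nat) (a : homTo C n) : Prop :=
  monic (tagged a).

Definition subobject_le (C : triangularCategory) (n : nat)
    (a b : homTo C n) : Prop :=
  exists c : Hom C (tag a) (tag b), tcomp (tagged b) c = tagged a.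

(** * Bipartite graphs *)

(* {a + 1, ..., b} *)
Definition block (a b : nat) : {fset nat} := [fset i in iota a.+1 (b - a)].

Lemma in_block a b i : (i \in block a b) = (a < i <= b).
Proof. by rewrite !inE mem_iota; lia. Qed.

(* A graph is the pair of the size k of its basis {1, ..., k} and its edge set. *)
Definition bipartite (n : nat) (u : nat * {fset nat * nat}) : bool :=
  (u.1 <= n) && (u.2 `<=` block 0 u.1 `*` block u.1 n).

Record bip (n : nat) := Bip {
  bip_pair : nat * {fset nat * nat};
  bipP : bipartite n bip_pair
}.

HB.instance Definition _ n := [isSub for @bip_pair n].
HB.instance Definition _ n := [Countable of bip n by <:].

Definition bsize n (U : bip n) : nat := (bip_pair U).1.
Definition edges n (U : bip n) : {fset nat * nat} := (bip_pair U).2.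
Definition part1 n (U : bip n) : {fset nat} := block 0 (bsize U).
Definition part2 n (U : bip n) : {fset nat} := block (bsize U) n.

Lemma card_part1 n (U : bip n) : #|` part1 U| = bsize U.
Proof.
rewrite /part1 /block card_imfset //= undup_id ?iota_uniq //.
by rewrite size_iota subn0.
Qed.

Lemma bsize_le n (U : bip n) : bsize U <= n.
Proof. by case/andP: (bipP U). Qed.

Lemma edges_sub n (U : bip n) : edges U `<=` part1 U `*` part2 U.
Proof. by case/andP: (bipP U). Qed.

Lemma edgesP n (U : bip n) e :
  e \in edges U -> [/\ 0 < e.1, e.1 <= bsize U, bsize U < e.2 & e.2 <= n].
Proof.
move/(fsubsetP (edges_sub U)); rewrite in_fsetM !in_block.
by case/andP=> /andP[-> ->] /andP[-> ->].
Qed.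

Lemma bip_eq n (U V : bip n) :
  bsize U = bsize V -> edges U =i edges V -> U = V.
Proof.
move=> eb /fsetP ee; apply: val_inj => /=.
by move: eb ee; rewrite /bsize /edges; case: (bip_pair U) (bip_pair V) => ? ? [? ?] /= -> ->.
Qed.

Section BipFinite.
Variable n : nat.

Definition bip_code (U : bip n) : 'I_n.+1 * {fset 'I_n.+1 * 'I_n.+1} :=
  (inord (bsize U), [fset (inord e.1, inord e.2) | e in edges U]).

Definition bip_decode (c : 'I_n.+1 * {fset 'I_n.+1 * 'I_n.+1}) : option (bip n) :=
  insub (val c.1, [fset (val e.1, val e.2) | e in c.2]).

Lemma bip_codeK : pcancel bip_code bip_decode.
Proof.
move=> U; rewrite /bip_decode /= inordK ?ltnS ?bsize_le //.
rewrite (_ : (_, _) = bip_pair U); first by rewrite (valK U).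
rewrite [RHS]surjective_pairing; congr (_, _); apply/fsetP=> e.
have ordK d : d \in edges U ->
    (val (inord d.1 : 'I_n.+1), val (inord d.2 : 'I_n.+1)) = d.
  by case: d => i j /edgesP[/= *]; rewrite !inordK //; lia.
apply/imfsetP/idP => /= [[_ /imfsetP[d /= dU ->] ->]|eU] /=.
  by rewrite ordK.
exists (inord e.1, inord e.2); last by rewrite /= ordK.
by apply/imfsetP; exists e.
Qed.

HB.instance Definition _ : isFinite (bip n) := PCanIsFinite bip_codeK.

End BipFinite.

(** * The partial order on the bipartite graphs on {1, ..., n} *)

Definition bip_le n (U V : bip n) : bool :=
  (#|` part1 U| <= #|` part1 V|) &&
  ([fset e in edges U | e.2 > #|` part1 V|] ==
   [fset e in edges V | e.1 <= #|` part1 U|]).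

Lemma bip_leP n (U V : bip n) :
  reflect (bsize U <= bsize V /\
           forall e, (e \in edges U) && (bsize V < e.2) =
                     (e \in edges V) && (e.1 <= bsize U))
          (bip_le U V).
Proof.
rewrite /bip_le !card_part1; apply: (iffP andP) => -[-> eUV]; split=> //.
  by move=> e; move/eqP/fsetP/(_ e): eUV; rewrite !inE.
by apply/eqP/fsetP=> e; rewrite !inE; apply: eUV.
Qed.

Lemma bip_le_refl n : reflexive (@bip_le n).
Proof.
move=> U; apply/bip_leP; split=> // e.
by case: (boolP (e \in edges U)) => //= /edgesP[_ -> ->].
Qed.

Lemma bip_le_anti n : antisymmetric (@bip_le n).
Proof.
move=> U V /andP[/bip_leP[leUV eUV] /bip_leP[leVU _]].
have eb : bsize U = bsize V by lia.
apply: bip_eq => // e; move: (eUV e).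
have -> : (e \in edges U) && (bsize V < e.2) = (e \in edges U).
  by case: (boolP (_ \in _)) => //= /edgesP[_ _]; rewrite eb.
by case: (boolP (e \in edges V)) => //= /edgesP[_]; rewrite -eb => ->.
Qed.

Lemma bip_le_trans n : transitive (@bip_le n).
Proof.
move=> V U W /bip_leP[leUV eUV] /bip_leP[leVW eVW].
apply/bip_leP; split; first exact: leq_trans leVW.
move=> e; move: (eUV e) (eVW e).
have [ltWe|_] := ltnP (bsize W) e.2; rewrite ?andbF ?andbT.
  rewrite (leq_ltn_trans leVW ltWe) andbT => -> ->; rewrite -andbA.
  by have [leU|_] := leqP e.1 (bsize U); rewrite ?andbF // (leq_trans leU leUV).
by have [leU|_] := leqP e.1 (bsize U); rewrite ?andbF // (leq_trans leU leUV).
Qed.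

Fact bip_display : Order.disp_t. Proof. exact: Order.Disp tt tt. Qed.

HB.instance Definition _ n :=
  Order.Le_isPOrder.Build bip_display (bip n)
    (@bip_le_refl n) (@bip_le_anti n) (@bip_le_trans n).

(** * The category of bipartite graphs *)

Definition bipHom (k n : nat) := {U : bip n | bsize U == k}.

Lemma bsize_hom k n (U : bipHom k n) : bsize (val U) = k.
Proof. exact/eqP/(valP U). Qed.

Lemma bipHom_eq k n (U V : bipHom k n) :
  edges (val U) =i edges (val V) -> U = V.
Proof. by move=> eUV; apply/val_inj/bip_eq; rewrite // !bsize_hom. Qed.

Lemma edges_homP k n (U : bipHom k n) e :
  e \in edges (val U) -> [/\ 0 < e.1, e.1 <= k, k < e.2 & e.2 <= n].
Proof. by move/edgesP; rewrite bsize_hom. Qed.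

Lemma leq_hom k n (U : bipHom k n) : k <= n.
Proof. by rewrite -(bsize_hom U) bsize_le. Qed.

Lemma bipId_subproof n : bipartite n (n, fset0).
Proof. by rewrite /bipartite leqnn fsub0set. Qed.

Definition bipId n : bipHom n n := Sub (Bip (bipId_subproof n)) (eqxx n).

Lemma bipComp_subproof m k n (V : bipHom k n) (U : bipHom m k) :
  bipartite n (m, edges (val U) `|` [fset e in edges (val V) | e.1 <= m]).
Proof.
have [lemk lekn] := (leq_hom U, leq_hom V).
rewrite /bipartite (leq_trans lemk) //=; apply/fsubsetP=> e.
rewrite in_fsetM !in_block !inE /=.
case/orP=> [/edges_homP[-> -> -> lek]|/andP[/edges_homP[-> _ ltk ->] lem]] /=.
  exact: leq_trans lek lekn.
by rewrite lem (leq_ltn_trans lemk ltk).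
Qed.

Definition bipComp m k n (V : bipHom k n) (U : bipHom m k) : bipHom m n :=
  Sub (Bip (bipComp_subproof V U)) (eqxx m).

Lemma in_bipComp m k n (V : bipHom k n) (U : bipHom m k) e :
  (e \in edges (val (bipComp V U))) =
  (e \in edges (val U)) || (e \in edges (val V)) && (e.1 <= m).
Proof. by rewrite /edges /= !inE. Qed.

Lemma bipComp1f m n (f : bipHom m n) : bipComp (bipId n) f = f.
Proof. by apply: bipHom_eq => e; rewrite in_bipComp !inE orbF. Qed.

Lemma bipCompf1 m n (f : bipHom m n) : bipComp f (bipId m) = f.
Proof.
apply: bipHom_eq => e; rewrite in_bipComp !inE /=.
by case: (boolP (_ \in _)) => //= /edges_homP[].
Qed.

Lemma bipCompA l m k n (h : bipHom k n) (g : bipHom m k) (f : bipHom l m) :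
  bipComp h (bipComp g f) = bipComp (bipComp h g) f.
Proof.
have lelm := leq_hom f.
apply: bipHom_eq => e; rewrite !in_bipComp.
have [lel|_] := leqP e.1 l; last by rewrite !andbF !orbF.
by rewrite (leq_trans lel lelm) !andbT orbA.
Qed.

Lemma card_bipHom_diag n : #|{: bipHom n n}| = 1.
Proof.
apply/eqP/fintype1P; exists (bipId n) => f; apply: bipHom_eq => e.
by rewrite [RHS]inE; apply/negP=> /edges_homP[]; lia.
Qed.

Lemma card_bipHom_gt m n : n < m -> #|{: bipHom m n}| = 0.
Proof. by move=> ltnm; apply: eq_card0 => f; have := leq_hom f; lia. Qed.

Definition bipCat : triangularCategory :=
  TriangularCategory bipComp1f bipCompf1 bipCompA card_bipHom_diag card_bipHom_gt.

(* A graph with basis {1, ..., k} seen as a morphism k -> n. *)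
Definition bip_hom n (U : bip n) : Hom bipCat (bsize U) n :=
  (Sub U (eqxx (bsize U)) : bipHom (bsize U) n).

Definition bip_homTo n (U : bip n) : homTo bipCat n :=
  existT _ (bsize U) (bip_hom U).

(* Main.v *)
(* The edges (i, j) of [V • W] coming from W have j <= |Y_1|, those coming from
   V have j > |Y_1|.  So W can be read off [V • W], which makes every morphism
   monic, and [V • W = U] forces W to be the part j <= |Y_1| of U and the part
   j > |Y_1| of U to be the part i <= |X_1| of V. *)
Require Import Defs.
From mathcomp Require Import all_boot all_order finmap.

Set Implicit Arguments.
Unset Strict Implicit.
Unset Printing Implicit Defensive.

Local Open Scope fset_scope.

Lemma bipComp_low m k n (V : bipHom k n) (W : bipHom m k) e :
  (e \in edges (val (bipComp V W))) && (e.2 <= k) = (e \in edges (val W)).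
Proof.
rewrite in_bipComp; apply/idP/idP => [/andP[/orP[//|/andP[eV _]] lek]|eW].
  by have [_ _] := edges_homP eV; rewrite ltnNge lek.
by have [_ _ _ ->] := edges_homP eW; rewrite eW.
Qed.

Lemma bipCat_monic k n (f : Hom bipCat k n) : monic f.
Proof.
move=> m g h /= fgh; apply: bipHom_eq => e.
by rewrite -(bipComp_low f g) -(bipComp_low f h) fgh.
Qed.

Lemma bipCut_subproof n (U : bip n) k : bsize U <= k ->
  bipartite k (bsize U, [fset e in edges U | e.2 <= k]).
Proof.
move=> leUk; rewrite /bipartite leUk; apply/fsubsetP=> e.
by rewrite in_fsetM !in_block !inE /= => /andP[/edgesP[-> -> -> _] ->].
Qed.

(** By [bipComp_low], this is the only candidate for [W] in [V • W = U] when [V] has basis size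
    [k]. *)
Definition bipCut n (U : bip n) k (leUk : bsize U <= k) : bipHom (bsize U) k :=
  Sub (Bip (bipCut_subproof leUk)) (eqxx (bsize U)).

Lemma in_bipCut n (U : bip n) k (leUk : bsize U <= k) e :
  (e \in edges (val (bipCut leUk))) = (e \in edges U) && (e.2 <= k).
Proof. by rewrite /edges /= !inE. Qed.

Lemma bip_le_factor n (U V : bip n) :
  bip_le U V <->
  exists W : Hom bipCat (bsize U) (bsize V), tcomp (bip_hom V) W = bip_hom U.
Proof.
split=> [/bip_leP[leUV eUV]|[W VWU]].
  exists (bipCut leUV : Hom bipCat _ _); apply: bipHom_eq => e.
  (* By [eUV], the edges contributed by [V] are those of [U] with [j > |Y_1|]; the cut supplies the
     rest. *)
  by rewrite in_bipComp in_bipCut -eUV -andb_orr leqNgt orNb andbT.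
apply/bip_leP; split=> [|e]; first exact: leq_hom W.
have -> : edges U = edges (val (bipComp (bip_hom V) W)).
  exact: esym (congr1 (fun f : bipHom (bsize U) n => edges (val f)) VWU).
rewrite in_bipComp andb_orl; have -> : edges (val (bip_hom V)) = edges V by [].
(* An edge of [W] has [j <= |Y_1|], so both sides are false; otherwise [e] can only come from [V],
   where [j > |Y_1|] is automatic. *)
have [eW|_] := boolP (e \in edges (val W)).
  have [_ _ _ leV] := edges_homP eW; rewrite ltnNge leV andbF /=.
  by have [/edgesP[_ _]|] := boolP (e \in edges V); rewrite // ltnNge leV.
by have [/edgesP[_ _ -> _]|] := boolP (e \in edges V); rewrite //= andbT.
Qed.

Theorem proposition7 (n : nat) :
  [/\ (* the set of graphs on {1, ..., n} is the set S(n) *)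
      injective (@bip_homTo n),
      forall a : homTo bipCat n, subobject a <-> exists U : bip n, bip_homTo U = a,
      (* its order is the natural partial order *)
      forall U V : bip n,
        (U <= V)%O <-> subobject_le (bip_homTo U) (bip_homTo V)
    & (* explicitly *)
      forall U V : bip n,
        (#|` part1 U| <= #|` part1 V| /\
         [fset e in edges U | e.2 > #|` part1 V|] =
         [fset e in edges V | e.1 <= #|` part1 U|])
        <->
        exists W : Hom bipCat (bsize U) (bsize V),
          tcomp (bip_hom V) W = bip_hom U].
Proof.
split=> [U V eUV|a|U V|U V].
(* A left inverse of [bip_homTo], which avoids comparing dependent pairs. *)
- pose graph (a : homTo bipCat n) : bip n := val (tagged a : bipHom (tag a) n).
  exact: (congr1 graph eUV).
- split=> [_|_]; last exact: bipCat_monic.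
  (* Once [k] is replaced by [bsize U], both morphisms have the same type and the same underlying
     graph. *)
  case: a => k [U kU]; exists U; have eUk := eqP kU; subst k.
  by congr existT; apply: val_inj.
- exact: bip_le_factor.
- rewrite -bip_le_factor /bip_le; split=> [[-> ->]|/andP[-> /eqP->]] //.
  by rewrite eqxx.
Qed.
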